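(* Let $y(j)$, $j=0,1,2,\dots$, be integers with $y(0)=1$. Define coefficients $R_y^{-1}(n,k)$, $n,k\ge0$, by $$R_y^{-1}(n,k)=2^{(n-k)/2}\frac{(n-1)!}{(k-1)!}\langle t^{-k}\rangle U_y^{-n}(t),\qquad\text{where } U_y(t):=\sum_{j\ge0}\frac{y(j)}{(2j+1)!}t^{2j+1},$$ and where the case $k=0$ has to be interpreted as $R_y^{-1}(0,0)=1$ and $R_y^{-1}(n,0)=0$ for $n\ge1$. Then, for fixed $n$ and any $2$-power $2^e$, the sequence $\bigl(R_y^{-1}(k+2n,k)\bigr)_{k\ge0}$ is purely periodic modulo $2^e$ with (not necessarily minimal) period length $2^e$.
   Context: For a formal Laurent series $F(t)$, $\langle t^N\rangle F(t)$ denotes the coefficient of $t^N$ in $F(t)$. A sequence $(a(k))_{k\ge0}$ is purely periodic modulo $M$ with (not necessarily minimal) period length $L$ if $a(k+L)\equiv a(k)\pmod M$ for all $k\ge0$. Here $n$ is a non-negative integer; the numbers $R_y^{-1}(k+2n,k)$ are integers. *)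

(* Defs.v *)
From HB Require Import structures.
From mathcomp Require Import all_boot all_order all_algebra.
From mathcomp Require Import boolp classical_sets functions cardinality fsbigop.
From mathcomp Require Import zify.

Set Implicit Arguments.
Unset Strict Implicit.
Unset Printing Implicit Defensive.

Import Order.TTheory GRing.Theory Num.Theory.
Local Open Scope classical_set_scope.
Local Open Scope ring_scope.

Section LaurentType.
Variable K : fieldType.
Implicit Types (f g h : int -> K) (a b : nat) (N : int).

Definition pole_le a f := forall i : int, i < - a%:Z -> f i = 0.

(* Formal Laurent series [\sum_i f i * t^i], [i] ranging over [int], with finite principal part. *)
Record laurent := Laurent {
  coefl :> int -> K;
  coefl_pole : exists a : nat, pole_le a coefl }.

Lemma laurentP (F G : laurent) : coefl F =1 coefl G -> F = G.
Proof.
case: F G => [f pf] [g pg] /= /funext fg; case: _ / fg in pg *.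
by congr Laurent; exact: Prop_irrelevance.
Qed.

HB.instance Definition _ := gen_eqMixin laurent.
HB.instance Definition _ := gen_choiceMixin laurent.

Lemma pole_le0 a : pole_le a (fun=> 0). Proof. by []. Qed.

Lemma pole_leW a b f : (a <= b)%N -> pole_le a f -> pole_le b f.
Proof. by move=> ab fa i ib; apply: fa; lia. Qed.

Lemma pole_leN a f : pole_le a f -> pole_le a (fun i => - f i).
Proof. by move=> fa i /fa ->; rewrite oppr0. Qed.

Lemma pole_leD a f g :
  pole_le a f -> pole_le a g -> pole_le a (fun i => f i + g i).
Proof. by move=> fa ga i ia; rewrite fa// ga// addr0. Qed.

Lemma coefl_pole2 (F G : laurent) : exists a, pole_le a F /\ pole_le a G.
Proof.
have [a Fa] := coefl_pole F; have [b Gb] := coefl_pole G.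
by exists (a + b)%N; split; [apply: pole_leW Fa | apply: pole_leW Gb]; lia.
Qed.

(* The sum has finite support when [f] and [g] have finite principal parts. *)
Definition conv f g N : K := \sum_(i \in [set: int]) f i * g (N - i).

Lemma convE a b f g N M : pole_le a f -> pole_le b g -> N + a%:Z + b%:Z < M%:Z ->
  conv f g N = \sum_(j < M) f (j%:Z - a%:Z) * g (N + a%:Z - j%:Z).
Proof.
move=> fa gb NM; pose r := [seq j%:Z - a%:Z | j <- iota 0 M].
rewrite /conv (fsbigE r) //.
- rewrite (eq_bigl xpredT) => [|i]; last by rewrite in_setT.
  rewrite big_map -[X in iota 0 X](subn0 M) -/(index_iota 0 M) big_mkord.
  by apply: eq_bigr => j _; congr (_ * g _); lia.
- by rewrite map_inj_uniq ?iota_uniq// => i j; lia.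
- move=> i _ ir; have [ia|ia] := ltP i (- a%:Z); first by rewrite fa// mul0r.
  rewrite gb ?mulr0//; have [//|iN] := ltP (N - i) (- b%:Z).
  case/negP: ir; apply/mapP; exists (absz (i + a%:Z)); last by lia.
  by rewrite mem_iota; lia.
Qed.

Definition trunc a n f : {poly K} := \poly_(j < n) f (j%:Z - a%:Z).

Lemma coef_trunc a n f m : (m < n)%N -> (trunc a n f)`_m = f (m%:Z - a%:Z).
Proof. by move=> mn; rewrite coef_poly mn. Qed.

Lemma conv_trunc a b n f g m : pole_le a f -> pole_le b g -> (m < n)%N ->
  conv f g (m%:Z - (a + b)%N%:Z) = (trunc a n f * trunc b n g)`_m.
Proof.
move=> fa gb mn; rewrite (@convE a b _ _ _ m.+1) //; last by lia.
rewrite coefM; apply: eq_bigr => j _; have := ltn_ord j => jm.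
by rewrite !coef_trunc; [congr (_ * g _)|..]; lia.
Qed.

Lemma pole_le_conv a b f g :
  pole_le a f -> pole_le b g -> pole_le (a + b) (conv f g).
Proof.
move=> fa gb i iab; rewrite (@convE a b _ _ _ 0%N) ?big_ord0 //; lia.
Qed.

Lemma eq_coefM (p p' q q' : {poly K}) m :
    (forall i, (i <= m)%N -> p`_i = p'`_i) ->
    (forall i, (i <= m)%N -> q`_i = q'`_i) ->
  (p * q)`_m = (p' * q')`_m.
Proof.
move=> pp qq; rewrite !coefM; apply: eq_bigr => j _.
by rewrite pp ?qq ?leq_subr// -ltnS.
Qed.

Lemma pole_ext a f g : pole_le a f -> pole_le a g ->
  (forall m : nat, f (m%:Z - a%:Z) = g (m%:Z - a%:Z)) -> f =1 g.
Proof.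
move=> fa ga fg i; have [ia|ia] := ltP i (- a%:Z); first by rewrite fa ?ga.
by have -> : i = (absz (i + a%:Z))%:Z - a%:Z by lia.
Qed.

Definition onef (i : int) : K := (i == 0)%:R.

Lemma pole_le1 : pole_le 0 onef.
Proof. by move=> i; rewrite /onef; case: eqP => // ->. Qed.

Program Definition zerol := @Laurent (fun=> 0) _.
Next Obligation. by exists 0%N. Qed.
Program Definition onel := @Laurent onef _.
Next Obligation. by exists 0%N; exact: pole_le1. Qed.
Program Definition oppl (F : laurent) := @Laurent (fun i => - F i) _.
Next Obligation. by have [a Fa] := coefl_pole F; exists a; apply: pole_leN. Qed.
Program Definition addl (F G : laurent) := @Laurent (fun i => F i + G i) _.
Next Obligation.
by have [a [Fa Ga]] := coefl_pole2 F G; exists a; apply: pole_leD.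
Qed.
Program Definition mull (F G : laurent) := @Laurent (conv F G) _.
Next Obligation.
have [a [Fa Ga]] := coefl_pole2 F G.
by exists (a + a)%N; apply: pole_le_conv.
Qed.

Lemma addlA : associative addl.
Proof. by move=> F G H; apply: laurentP => i /=; rewrite addrA. Qed.
Lemma addlC : commutative addl.
Proof. by move=> F G; apply: laurentP => i /=; rewrite addrC. Qed.
Lemma add0l : left_id zerol addl.
Proof. by move=> F; apply: laurentP => i /=; rewrite add0r. Qed.
Lemma addNl : left_inverse zerol oppl addl.
Proof. by move=> F; apply: laurentP => i /=; rewrite addNr. Qed.

HB.instance Definition _ := GRing.isZmodule.Build laurent
  addlA addlC add0l addNl.

Lemma mullC : commutative mull.
Proof.
move=> F G; apply: laurentP; have [a [Fa Ga]] := coefl_pole2 F G.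
apply: (@pole_ext (a + a)) => [||m]; [exact: pole_le_conv..|] => /=.
by rewrite !(conv_trunc (n := m.+1)) // mulrC.
Qed.

Lemma mullA : associative mull.
Proof.
move=> F G H; apply: laurentP.
have [a Fa] := coefl_pole F; have [b Gb] := coefl_pole G.
have [c Hc] := coefl_pole H.
apply: (@pole_ext (a + b + c)) => [||m].
- by rewrite -addnA; apply: pole_le_conv => //; apply: pole_le_conv.
- by apply: pole_le_conv => //; apply: pole_le_conv.
- rewrite [RHS](conv_trunc (n := m.+1)) //; last exact: pole_le_conv.
  rewrite -addnA [LHS](conv_trunc (n := m.+1)) //; last exact: pole_le_conv.
  transitivity ((trunc a m.+1 F * (trunc b m.+1 G * trunc c m.+1 H))`_m).
    apply: eq_coefM => // i im.
    by rewrite coef_trunc ?ltnS //= (conv_trunc (n := m.+1)).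
  rewrite mulrA; apply: eq_coefM => // i im.
  by rewrite coef_trunc ?ltnS //= (conv_trunc (n := m.+1)).
Qed.

Lemma mul1l : left_id onel mull.
Proof.
move=> F; apply: laurentP; have [a Fa] := coefl_pole F.
apply: (@pole_ext a) => // [|m].
  by rewrite -[a]add0n; apply: pole_le_conv => //; exact: pole_le1.
rewrite -{1}[a]add0n [LHS](conv_trunc (n := m.+1)) //; last exact: pole_le1.
transitivity ((1%:P * trunc a m.+1 F)`_m); last by rewrite mul1r coef_trunc.
apply: eq_coefM => // i im; rewrite coef_trunc ?ltnS// coefC subr0.
by rewrite /= /onef; case: i im.
Qed.

Lemma mullDl : left_distributive mull addl.
Proof.
move=> F G H; apply: laurentP; have [a [Fa Ga]] := coefl_pole2 F G.
have [b Hb] := coefl_pole H; have FGa := pole_leD Fa Ga.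
apply: (@pole_ext (a + b)) => [||m].
- exact: pole_le_conv.
- by apply: pole_leD; apply: pole_le_conv.
- rewrite /= !(conv_trunc (n := m.+1)) // -coefD -mulrDl.
  by apply: eq_coefM => // i im; rewrite coefD !coef_trunc.
Qed.

Lemma onel_neq0 : onel != zerol.
Proof.
apply/eqP => /(congr1 (fun F : laurent => F 0)) /=.
by rewrite /onef eqxx => /eqP; rewrite oner_eq0.
Qed.

HB.instance Definition _ := GRing.Zmodule_isComNzRing.Build laurent
  mullA mullC mul1l mullDl onel_neq0.

(* The monomial [t^s]. *)
Program Definition monl (s : int) := @Laurent (fun i => (i == s)%:R) _.
Next Obligation. by exists (absz s) => i si; case: eqP => //; lia. Qed.

Lemma coefl_monM s (F : laurent) N : (monl s * F) N = F (N - s).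
Proof.
rewrite -[LHS]/(\sum_(i \in [set: int]) (i == s)%:R * F (N - i)).
rewrite (fsbigE [:: s]) //; last first.
  by move=> i _; rewrite inE => /negPf ->; rewrite mul0r.
by rewrite big_cons big_nil in_setT eqxx mul1r; exact: addr0.
Qed.

Lemma monl0 : monl 0 = 1. Proof. exact: laurentP. Qed.

Lemma monlD s s' : monl (s + s') = monl s * monl s'.
Proof.
apply: laurentP => N; rewrite coefl_monM /=.
by congr (_%:R); apply/eqP/eqP; lia.
Qed.

(* The first [n] coefficients, in reverse order, of the inverse of the power
   series [\sum_i c i * t^i]. *)
Fixpoint invs (c : nat -> K) n : seq K :=
  if n is n'.+1 then
    (c 0%N)^-1 * ((n' == 0%N)%:R
      - \sum_(i < n') c i.+1 * (invs c n')`_i) :: invs c n'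
  else [::].

Lemma nth_invs c n i :
  (i < n)%N -> (invs c n)`_i = (invs c (n - i))`_0.
Proof. by elim: n i => // n IH [|i] //= /IH ->. Qed.

Lemma pseries_inv (c : nat -> K) : c 0%N != 0 ->
  exists h : nat -> K, forall m,
    \sum_(i < m.+1) c i * h (m - i)%N = (m == 0%N)%:R.
Proof.
move=> c0; exists (fun n => (invs c n.+1)`_0) => m.
rewrite big_ord_recl subn0 [X in _ * X]/= mulVKf //.
rewrite [X in _ + X](_ : _ = \sum_(i < m) c i.+1 * (invs c m)`_i) ?subrK //.
apply: eq_bigr => i _; rewrite lift0 (@nth_invs _ m) //.
by rewrite subnSK.
Qed.

Lemma mull_inv_ex (F : laurent) : F != 0 -> exists G, G * F = 1.
Proof.
move=> F0; have [a Fa] := coefl_pole F.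
have exj : exists j : nat, F (j%:Z - a%:Z) != 0.
  apply: contrapT => /forallNP noj; case/eqP: F0; apply: laurentP.
  by apply: (@pole_ext a) => // m; apply/eqP; apply: contrapT => /negP/noj.
case: (ex_minnP exj) => d Fd dmin; pose s := a%:Z - d%:Z.
have F0lt : pole_le 0 (monl s * F).
  move=> i i0; rewrite coefl_monM; have [?|ia] := ltP (i - s) (- a%:Z).
    exact: Fa.
  have eqi : i - s = (absz (i - s + a%:Z))%:Z - a%:Z by lia.
  apply/eqP; apply: contraT; rewrite eqi => /dmin; rewrite /s; lia.
have [|h hP] := @pseries_inv (fun n => (monl s * F) n%:Z).
  by rewrite coefl_monM sub0r opprB.
pose gf (i : int) := if i is Posz n then h n else 0.
have gf0 : pole_le 0 gf by case=> // n.
pose G0 := Laurent (ex_intro _ 0%N gf0).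
have G0F : (monl s * F) * G0 = 1.
  apply: laurentP; apply: (@pole_ext 0) => [||m].
  - exact: (@pole_le_conv 0 0).
  - exact: pole_le1.
  - transitivity ((m == 0%N)%:R : K); last by rewrite subr0.
    rewrite [LHS](@conv_trunc 0 0 m.+1) // coefM -hP.
    apply: eq_bigr => i _.
    by rewrite coef_trunc // coef_trunc ?ltnS ?leq_subr // !subr0.
by exists (G0 * monl s); rewrite -mulrA mulrC.
Qed.

Definition invl (F : laurent) : laurent :=
  match pselect (exists G, G * F = 1) with
  | left ex => projT1 (cid ex)
  | right _ => 0
  end.

Lemma mulVl (F : laurent) : F != 0 -> invl F * F = 1.
Proof.
by move=> /mull_inv_ex exG; rewrite /invl; case: pselect => // ex; case: cid.
Qed.

Lemma invl0 : invl 0 = 0.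
Proof.
rewrite /invl; case: pselect => // ex; case: cid => G /= /eqP.
by rewrite mulr0 eq_sym oner_eq0.
Qed.

HB.instance Definition _ := GRing.ComNzRing_isField.Build laurent mulVl invl0.

End LaurentType.

Arguments monl {K}.

Definition U_ser_coef (y : nat -> int) (i : int) : rat :=
  if i is Posz m then
    if odd m then (y m./2)%:~R / (m`!)%:R else 0
  else 0.

Lemma U_ser_pole (y : nat -> int) : exists a : nat, pole_le a (U_ser_coef y).
Proof. by exists 0%N; case. Qed.

(* [\sum_(j >= 0) y(j) / (2j+1)! t^(2j+1)] *)
Definition U_ser (y : nat -> int) : laurent rat := Laurent (U_ser_pole y).

Lemma coefl_U_ser_odd y (j : nat) :
  U_ser y (2 * j + 1)%N = (y j)%:~R / ((2 * j + 1)`!)%:R.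
Proof. by rewrite /= addn1 mul2n /= odd_double uphalf_double. Qed.

Lemma U_ser_neq0 y : y 0%N = 1 -> U_ser y != 0.
Proof.
move=> y0; apply/eqP => /(congr1 (fun F : laurent rat => F 1)) /=.
by rewrite y0.
Qed.

(* The factor [2^((n-k)/2)] only matters for [n - k] even: [U_ser y] is odd, so the
   Laurent coefficient vanishes when [n - k] is odd, and rounding the exponent
   is harmless.  For [n = 0 < k], where [(n-1)!] is undefined, the Laurent
   coefficient is that of [t^(-k)] in [1], hence the value is 0. *)
Definition R_inv (y : nat -> int) (n k : nat) : rat :=
  if k == 0%N then (n == 0%N)%:R
  else 2 ^ ((n%:Z - k%:Z) %/ 2)%Z * (n.-1`!%:R / k.-1`!%:R)
       * coefl ((U_ser y) ^- n) (- k%:Z).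

(* Pure periodicity, from index 0 on; [L] need not be minimal. *)
Definition purely_periodic_mod (M L : nat) (a : nat -> int) : Prop :=
  forall k : nat, (a (k + L)%N = a k %[mod M%:Z])%Z.

(* Main.v *)
Require Import Defs.
From mathcomp Require Import all_boot all_order all_algebra.
From mathcomp Require Import boolp fsbigop.
From mathcomp Require Import zify ring.

(**
Factor the odd series as [U = t (1 + x)] with [x = O(t^2)].  Then, with
[N = k + 2n], the coefficient of [t^(-k)] in [U^(-N)] is the coefficient of
[t^(2n)] in [(1 + x)^(-N)], and in the negative binomial expansion only the
powers [x^m] with [m <= n] contribute.  Absorbing the quotient of factorials
into the binomial coefficients gives ([R_inv_binomial])

  [R_inv y (k + 2n) k = 2^n * \sum_(m <= n) (-1)^m T_m 'C(k + 2n + m - 1, 2n + m)],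

where [T_m = (2n + m)! <t^(2n + m)> (U - t)^m / m!] depends only on [n] and [m].
So, up to the factor [2^n], the sequence is a polynomial in [k] of degree at most
[3n], written in a binomial basis.

Two facts finish the proof.

The [T_m] are integers ([tail_ser_exp_int]): the series [U - t] is an exponential
generating function with integer coefficients and no constant term, and the
divided powers [f^m / m!] of such a series have integer coefficients again
([egf_int_divided_power]).

The factor [2^n] pays for the denominators ([binomial_shift_pow2]): by
Vandermonde, shifting the argument of ['C(_, r)] by [2^e] adds multiples of
['C(2^e, i)] with [1 <= i <= r], and the 2-adic valuation of ['C(2^e, i)] is
at least [e - v_2(i)].  Here [i <= 3n < 2^(n+1)], so [v_2(i) <= n].
*)

Set Implicit Arguments.
Unset Strict Implicit.
Unset Printing Implicit Defensive.

Import Order.TTheory GRing.Theory Num.Theory.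
Local Open Scope ring_scope.

(** * Binomial coefficients modulo powers of two *)

(** The absorption identity [i * 'C(2^e, i) = 2^e * 'C(2^e - 1, i - 1)] shows that
    only the 2-part of [i], which is at most [2^n], can be missing. *)
Lemma dvdn_pow2_binomial n e i : (0 < i < 2 ^ n.+1)%N ->
  (2 ^ e %| 2 ^ n * 'C(2 ^ e, i))%N.
Proof.
case/andP=> i_gt0 i_lt.
have [u u_odd def_i] := pfactor_coprime (isT : prime 2) i_gt0.
have le_vn : (logn 2 i <= n)%N.
  rewrite -ltnS -(ltn_exp2l _ _ (ltnSn 1)); apply: leq_ltn_trans i_lt.
  by apply: dvdn_leq => //; exact: pfactor_dvdnn.
have: (2 ^ e %| i * 'C(2 ^ e, i))%N.
  case: i i_gt0 {i_lt u_odd def_i le_vn} => // i _.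
  have e_gt0 : (0 < 2 ^ e)%N by rewrite expn_gt0.
  by rewrite -[X in 'C(X, _)](prednK e_gt0) -mul_bin_diag prednK // dvdn_mulr.
rewrite {1}def_i -mulnA Gauss_dvdr ?coprimeXl // => dvd_e.
by rewrite -(subnK le_vn) expnD -mulnA dvdn_mull.
Qed.

(** The term [i = 0] of the Vandermonde expansion of ['C(2^e + N, r)] is
    ['C(N, r)]; the others vanish by [dvdn_pow2_binomial]. *)
Lemma binomial_shift_pow2 n e r N : (r < 2 ^ n.+1)%N ->
  (2 ^ n * 'C(N + 2 ^ e, r) = 2 ^ n * 'C(N, r) %[mod 2 ^ e])%N.
Proof.
move=> r_lt; rewrite addnC -binomial.Vandermonde big_ord_recl bin0 mul1n subn0.
rewrite mulnDr big_distrr /= addnC -modnDml.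
suff /eqP -> : (2 ^ e %| \sum_(i < r)
    2 ^ n * ('C(2 ^ e, bump 0 i) * 'C(N, r - bump 0 i)))%N by rewrite add0n.
apply: dvdn_sum => i _; rewrite mulnA dvdn_mulr // dvdn_pow2_binomial //.
by have := ltn_ord i; rewrite /bump /=; lia.
Qed.

(** [3n] bounds the lower indices [2n + m], [m <= n], that occur in
    [R_inv_binomial]. *)
Lemma triple_lt_pow2 n : (0 < n)%N -> (3 * n < 2 ^ n.+1)%N.
Proof.
by elim: n => // -[|n] IH _ //; have := IH isT; rewrite [(2 ^ n.+3)%N]expnS; lia.
Qed.

(** * Exponential generating functions with integer coefficients *)

Definition egf_int (p : {poly rat}) := forall i, i`!%:R * p`_i \is a Num.int.

Lemma egf_intM p q : egf_int p -> egf_int q -> egf_int (p * q).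
Proof.
move=> pI qI i; rewrite coefM big_distrr /=; apply: rpred_sum => j _.
have ji : (j <= i)%N by rewrite -ltnS.
rewrite -(bin_fact ji) !natrM.
rewrite (_ : _ * _ = 'C(i, j)%:R * (j`!%:R * p`_j * ((i - j)`!%:R * q`_(i - j)))).
  by rewrite rpredM ?rpred_nat // rpredM.
by ring.
Qed.

Lemma egf_int_deriv p : egf_int p -> egf_int p^`().
Proof.
move=> pI i; rewrite coef_deriv -(mulr_natl p`_i.+1) mulrA -natrM mulnC -factS.
exact: pI.
Qed.

(** Induction on [m], through the derivative:
    [(p^(m+1) / (m+1)!)' = (p^m / m!) * p'], and differentiation shifts the
    sequence [i! p_i], so integrality of the derivative gives that of all but the
    constant coefficient. *)
Lemma egf_int_divided_power (p : {poly rat}) m : p`_0 = 0 -> egf_int p ->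
  egf_int (m`!%:R^-1 *: p ^+ m).
Proof.
move=> p0 pI; elim: m => [|m IH].
  move=> [|i]; rewrite expr0 coefZ coefC /= ?mulr0 ?rpred0 //.
have fact_neq0 k : k`!%:R != 0 :> rat by rewrite pnatr_eq0 -lt0n fact_gt0.
case=> [|i].
  by rewrite coefZ exprS coef0M p0 mul0r !mulr0 rpred0.
have -> : (i.+1)`!%:R * (m.+1`!%:R^-1 *: p ^+ m.+1)`_i.+1
    = i`!%:R * ((m`!%:R^-1 *: p ^+ m) * p^`())`_i.
  transitivity (i`!%:R * ((m.+1`!%:R^-1 *: p ^+ m.+1)^`())`_i).
    by rewrite coef_deriv factS natrM -mulr_natr; ring.
  congr (_ * _`_i); rewrite derivZ deriv_exp -scalerAl [_ * p^`()]mulrC.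
  rewrite -scaler_nat scalerA.
  suff -> : (m.+1)`!%:R^-1 * m.+1%:R = m`!%:R^-1 :> rat by [].
  by rewrite factS natrM; field; rewrite fact_neq0 nat1r pnatr_eq0.
by rewrite egf_intM //; exact: egf_int_deriv.
Qed.

(** * The truncated negative binomial series *)

Section NegativeBinomial.
Variable R : comNzRingType.
Implicit Type x : R.

(** The expansion of [(1 + x)^(-N)] up to [x^n].  Thanks to the truncated
    predecessor, for [N = 0] the binomial coefficient is 1 if [m = 0] and 0
    otherwise, as it should be. *)
Definition negbin_trunc (n N : nat) x : R :=
  \sum_(m < n.+1) (-1) ^+ m * 'C((N + m).-1, m)%:R * x ^+ m.

Lemma negbin_trunc0 n x : negbin_trunc n 0 x = 1.
Proof.
rewrite /negbin_trunc big_ord_recl big1 ?addr0 ?mul1r // => i _.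
by rewrite lift0 add0n /= bin_small // mulr0 mul0r.
Qed.

(** Pascal's rule makes all terms up to [x^n] agree; what remains is the top
    term of the product with [x]. *)
Lemma negbin_truncS n N x : (1 + x) * negbin_trunc n N.+1 x =
  negbin_trunc n N x + (-1) ^+ n * 'C(N + n, n)%:R * x ^+ n.+1.
Proof.
rewrite /negbin_trunc; elim: n => [|n IH].
  by rewrite !big_ord1 /= !bin0 !expr0 !mul1r mulr1 expr1.
rewrite big_ord_recr mulrDr IH [in RHS]big_ord_recr /= -!addrA; congr (_ + _).
rewrite ?(addSn, addnS) /= binS natrD !exprS.
move: ((-1) ^+ n) (x ^+ n) 'C(N + n, n)%:R 'C(N + n, n.+1)%:R => s z a b.
by ring.
Qed.

End NegativeBinomial.

(** * Orders of vanishing of Laurent series *)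

Section Order.
Variable K : fieldType.
Implicit Types (F G : laurent K) (r s : int).

Definition order_ge r F := forall i, i < r -> F i = 0.

Lemma order_geW r s F : s <= r -> order_ge r F -> order_ge s F.
Proof. by move=> sr Fr i /lt_le_trans/(_ sr)/Fr. Qed.

Lemma order_geD r F G : order_ge r F -> order_ge r G -> order_ge r (F + G).
Proof. by move=> Fr Gr i ir; rewrite /= Fr ?Gr ?addr0. Qed.

Lemma order_geN r F : order_ge r F -> order_ge r (- F).
Proof. by move=> Fr i ir; rewrite /= Fr ?oppr0. Qed.

Lemma order_geM r s F G : order_ge r F -> order_ge s G -> order_ge (r + s) (F * G).
Proof.
move=> Fr Gs i irs; apply: fsbig1 => j _.
have [/Fr->|rj] := ltP j r; first by rewrite mul0r.
by rewrite Gs ?mulr0 //; lia.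
Qed.

Lemma order_ge1 : order_ge 0 1.
Proof. exact: pole_le1. Qed.

Lemma order_geX r F m : order_ge r F -> order_ge (r * m%:Z) (F ^+ m).
Proof.
move=> Fr; elim: m => [|m IH]; first by rewrite mulr0 expr0; exact: order_ge1.
by rewrite exprS intS mulrDr mulr1; exact: order_geM.
Qed.

Lemma order_ge_natmul r F m : order_ge r F -> order_ge r (F *+ m).
Proof.
by move=> Fr; elim: m => [|m IH] //; rewrite mulrS; exact: order_geD.
Qed.

Lemma one_plus_neq0 F : order_ge 1 F -> 1 + F != 0.
Proof.
move=> F1; apply/eqP => /(congr1 (fun H : laurent K => H 0)) /=.
by rewrite F1 // addr0 /onef eqxx => /eqP; rewrite oner_eq0.
Qed.

(** The inverse [G] satisfies [G = 1 - F G].  As [F] raises the order by at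
    least one, this improves any lower bound [- a.+1] on the order of [G] to
    [- a]; finiteness of the principal part provides the starting point. *)
Lemma order_ge0_inv F : order_ge 1 F -> order_ge 0 (1 + F)^-1.
Proof.
move=> F1; set G := _^-1.
have defG : G = 1 - F * G.
  by rewrite -[X in X - _](mulfV (one_plus_neq0 F1)) -/G mulrDl mul1r addrK.
have [a] : exists a, order_ge (- a%:Z) G by exact: coefl_pole.
elim: a => [|a IH Ga]; first by rewrite oppr0.
apply: IH; rewrite defG; apply: order_geD.
  by apply: order_geW order_ge1; lia.
apply/order_geN/(order_geW _ (order_geM F1 Ga)); lia.
Qed.

(** Transfers coefficients of powers to polynomials, where the formal derivative
    is available. *)
Lemma coefl_exp_trunc M F m i : order_ge 0 F -> (i < M)%N ->
  (F ^+ m) i%:Z = (trunc 0 M F ^+ m)`_i.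
Proof.
move=> F0; elim: m i => [|m IH] i iM.
  by rewrite !expr0 coefC /= /onef; case: i {iM}.
have Fm0 : order_ge 0 (F ^+ m) by rewrite -(mul0r m%:Z); exact: order_geX.
rewrite !exprS -[X in _ X = _]subr0 [LHS](@conv_trunc _ 0 0 M) //.
apply: eq_coefM => // j ji.
by rewrite coef_trunc ?subr0 ?IH //; lia.
Qed.

Lemma coeflMn F m i : (F *+ m) i = F i *+ m.
Proof. by elim: m => [|m IH] //; rewrite !mulrS /= IH. Qed.

Lemma coefl_sum I (s : seq I) (F : I -> laurent K) i :
  (\sum_(j <- s) F j) i = \sum_(j <- s) F j i.
Proof. by elim: s => [|j s IH]; rewrite ?big_nil // !big_cons /= IH. Qed.

Lemma coefl_signM F m i : ((-1) ^+ m * F) i = (-1) ^+ m * F i.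
Proof.
elim: m => [|m IH]; first by rewrite !expr0 !mul1r.
by rewrite !exprS !mulN1r !mulNr -IH.
Qed.

Lemma monlX s m : monl s ^+ m = monl (s * m%:Z) :> laurent K.
Proof.
elim: m => [|m IH]; first by rewrite mulr0 expr0 monl0.
by rewrite exprS IH -monlD intS mulrDr mulr1.
Qed.

Lemma order_ge_signM r m F : order_ge r F -> order_ge r ((-1) ^+ m * F).
Proof. by move=> Fr i ir; rewrite coefl_signM Fr ?mulr0. Qed.

Lemma order_ge_negbin r n N F : 0 <= r -> order_ge r F ->
  order_ge (r * n.+1%:Z) ((1 + F) ^+ N * negbin_trunc n N F - 1).
Proof.
move=> r0 Fr; elim: N => [|N IH].
  by rewrite negbin_trunc0 expr0 mulr1 subrr.
rewrite exprSr -mulrA negbin_truncS mulrDr addrAC; apply: order_geD => //.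
rewrite -[X in order_ge X]add0r; apply: order_geM.
  rewrite -(mul0r N%:Z); apply/order_geX/order_geD; first exact: order_ge1.
  exact: order_geW Fr.
rewrite mulrAC -mulrA mulr_natr; apply/order_ge_signM/order_ge_natmul.
exact: order_geX.
Qed.

(** Multiplying the estimate of [order_ge_negbin] by [(1 + F)^(-N)], a series
    without principal part, bounds the order of the difference between
    [(1 + F)^(-N)] and its truncated expansion. *)
Lemma coefl_inv_exp r n N F i : 1 <= r -> order_ge r F -> i < r * n.+1%:Z ->
  ((1 + F) ^- N) i =
  \sum_(m < n.+1) (-1) ^+ m * 'C((N + m).-1, m)%:R * (F ^+ m) i.
Proof.
move=> r1 Fr i_lt; have F1 := order_geW r1 Fr.
have iV0 : order_ge 0 ((1 + F) ^- N).
  by rewrite -exprVn -(mul0r N%:Z); apply/order_geX/order_ge0_inv.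
have := order_geM iV0 (@order_ge_negbin r n N F (le_trans ler01 r1) Fr).
rewrite mulrBr mulr1 mulrA mulVf ?expf_neq0 ?one_plus_neq0 // mul1r add0r.
move=> /(_ _ i_lt) /= /eqP.
rewrite subr_eq0 => /eqP <-; rewrite coefl_sum; apply: eq_bigr => m _.
by rewrite -mulrA coefl_signM -mulrA mulr_natl coeflMn mulr_natl.
Qed.

End Order.

(** * The coefficients of the inverse array *)

Definition tail_ser (y : nat -> int) : laurent rat := U_ser y - monl 1.

Lemma tail_ser_small y i : y 0%N = 1 -> i < 3 -> tail_ser y i = 0.
Proof.
move=> y0; case: i => [[|[|[|i]]]|i] //= _; rewrite ?y0 ?subr0 ?subrr //.
Qed.

Lemma tail_ser_egf y i : i`!%:R * tail_ser y i%:Z \is a Num.int.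
Proof.
rewrite /= mulrBr rpredB //; last by rewrite rpredM ?rpred_nat.
case: odd; last by rewrite mulr0 rpred0.
by rewrite mulrC divfK ?intr_int // pnatr_eq0 -lt0n fact_gt0.
Qed.

Lemma tail_ser_exp_int y m i : y 0%N = 1 ->
  i`!%:R / m`!%:R * (tail_ser y ^+ m) i%:Z \is a Num.int.
Proof.
move=> y0; pose p := trunc 0 i.+1 (tail_ser y).
have F0 : order_ge 0 (tail_ser y).
  by move=> j j0; apply: tail_ser_small => //; lia.
rewrite (coefl_exp_trunc _ F0 (ltnSn i)) -/p -mulrA -coefZ.
apply: egf_int_divided_power => [|j].
  by rewrite coef_trunc // tail_ser_small.
rewrite coef_poly; case: ltnP => _; last by rewrite mulr0.
by rewrite subr0 tail_ser_egf.
Qed.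

(** Besides the expansion of [(1 + x)^(-N)], [N = k + 2n], this rests on
    [(N-1)! / (k-1)! * 'C(N+m-1, m) = 'C(N+m-1, 2n+m) * (2n+m)! / m!].  It also
    covers the conventions at [k = 0]: there the binomial coefficients on the
    right vanish, except for [n = m = 0], where the truncated predecessor
    yields ['C(0, 0) = 1]. *)
Lemma R_inv_binomial y n k : y 0%N = 1 ->
  R_inv y (k + 2 * n) k = (2 ^ n)%:R * \sum_(m < n.+1)
    (-1) ^+ m * 'C((k + 2 * n + m).-1, 2 * n + m)%:R *
    ((2 * n + m)`!%:R / m`!%:R * (tail_ser y ^+ m) (2 * n + m)%:Z).
Proof.
move=> y0; rewrite /R_inv; have [->|k0] := eqVneq k 0%N.
  rewrite add0n; case: n => [|n].
    by rewrite big_ord1 /= bin0 /onef.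
  rewrite big1 ?mulr0 // => m _.
  by rewrite bin_small ?mulr0 ?mul0r //; lia.
set N := (k + 2 * n)%N.
have -> : ((N%:Z - k%:Z) %/ 2)%Z = n%:Z by rewrite /N; lia.
pose x := monl (-1) * tail_ser y.
have tailE : tail_ser y = monl 1 * x by rewrite mulrA -monlD subrr monl0 mul1r.
have UE : U_ser y = monl 1 * (1 + x).
  by rewrite mulrDr mulr1 -tailE addrCA subrr addr0.
have x2 : order_ge 2 x.
  by move=> i i2; rewrite coefl_monM tail_ser_small //; lia.
have coefx m : (tail_ser y ^+ m) (2 * n + m)%:Z = (x ^+ m) (2 * n)%:Z.
  by rewrite tailE exprMn monlX coefl_monM; congr (coefl _ _); lia.
have monV : (monl 1 ^+ N)^-1 = monl (- N%:Z) :> laurent rat.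
  by apply: mulr1_eq; rewrite monlX -monlD mul1r subrr monl0.
rewrite UE exprMn invfM monV coefl_monM.
have -> : - k%:Z - - N%:Z = (2 * n)%:Z by rewrite /N; lia.
rewrite (coefl_inv_exp (n := n) _ _ x2) //; last by lia.
rewrite natrX -exprnP -mulrA; congr (_ * _).
rewrite big_distrr; apply: eq_bigr => m _; rewrite coefx /=.
have fact_neq0 i : i`!%:R != 0 :> rat by rewrite pnatr_eq0 -lt0n fact_gt0.
have binE : 'C((N + m).-1, m)%:R * m`!%:R * N.-1`!%:R
    = 'C((N + m).-1, 2 * n + m)%:R * (2 * n + m)`!%:R * k.-1`!%:R :> rat.
  rewrite -!natrM -!mulnA; congr (_%:R).
  have -> : N.-1 = ((N + m).-1 - m)%N by rewrite /N; lia.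
  have -> : k.-1 = ((N + m).-1 - (2 * n + m))%N by rewrite /N; lia.
  by rewrite !bin_fact //; rewrite /N; lia.
have binE' : N.-1`!%:R / k.-1`!%:R * 'C((N + m).-1, m)%:R
    = 'C((N + m).-1, 2 * n + m)%:R * ((2 * n + m)`!%:R / m`!%:R) :> rat.
  apply: (@mulIf _ (m`!%:R * k.-1`!%:R)); first by rewrite mulf_neq0.
  transitivity ('C((N + m).-1, m)%:R * m`!%:R * N.-1`!%:R : rat).
    by field; rewrite fact_neq0.
  by rewrite binE; field; rewrite fact_neq0.
transitivity ((-1) ^+ m * (N.-1`!%:R / k.-1`!%:R * 'C((N + m).-1, m)%:R)
  * (x ^+ m) (2 * n)%:Z); first by ring.
by rewrite binE'; ring.
Qed.

Theorem theorem33 (y : nat -> int) (hy0 : y 0%N = 1%R) (n : nat) :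
  exists a : nat -> int,
    (forall k : nat, R_inv y (k + 2 * n) k = ((a k)%:~R)%R) /\
    (forall e : nat, purely_periodic_mod (2 ^ e) (2 ^ e) a).
Proof.
have Tint m : exists T : int,
    (2 * n + m)`!%:R / m`!%:R * (tail_ser y ^+ m) (2 * n + m)%:Z = T%:~R.
  by apply/intrP; exact: tail_ser_exp_int.
have [T defT] := choice Tint.
exists (fun k => \sum_(m < n.+1) (-1) ^+ m * T m *
  (2 ^ n * 'C((k + 2 * n + m).-1, 2 * n + m))%N%:Z); split=> [k|e k].
  rewrite R_inv_binomial // big_distrr rmorph_sum; apply: eq_bigr => m _ /=.
  by rewrite defT !rmorphM rmorphXn rmorphN1 /= -!pmulrn; ring.
apply/eqP; rewrite eqz_mod_dvd -sumrB.
apply: rpred_sum => m _; rewrite -mulrBr dvdz_mull // -eqz_mod_dvd.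
have m_le : (m <= n)%N by rewrite -ltnS.
rewrite !modz_nat eqz_nat; apply/eqP.
(* Only for [n = 0] can the predecessor truncate, and then [m = 0]. *)
have [n0|n_gt0] := posnP n.
  have -> : (2 * n + m = 0)%N by lia.
  by rewrite !bin0.
have -> : (k + 2 ^ e + 2 * n + m).-1 = ((k + 2 * n + m).-1 + 2 ^ e)%N by lia.
apply: binomial_shift_pow2; apply: leq_ltn_trans (triple_lt_pow2 n_gt0); lia.
Qed.
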